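(* Let $a<b$ be real numbers, let $\Omega=[a,b]\times[a,b]$, let $0<\alpha\le 1$, let $n\ge 1$ be an integer, and let $\Phi_1,\dots,\Phi_n:\Omega\to\mathbb{R}$ be functions of $(x,t)$ for which the iterates $D^{j\alpha}\Phi_i$ ($1\le i\le n$, $1\le j\le n-1$) of the operator $D^{\alpha}=\frac{\partial}{\partial t}+\frac{\partial^{\alpha}}{\partial x^{\alpha}}$ are defined at every point of $\Omega$, where $\frac{\partial^{\alpha}}{\partial x^{\alpha}}$ is the Caputo fractional partial derivative in $x$ with lower terminal $0$. If the fractional partial Wronskian $W^{\alpha}[\Phi_1,\dots,\Phi_n]$ is nonzero at at least one point of $\Omega$, then $\Phi_1,\dots,\Phi_n$ are linearly independent on $\Omega$; that is, if $k_1,\dots,k_n\in\mathbb{R}$ satisfy $k_1\Phi_1(x,t)+\dots+k_n\Phi_n(x,t)=0$ for all $(x,t)\in\Omega$, then $k_1=\dots=k_n=0$.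
   Context: Caputo fractional partial derivative with respect to $x$ of order $\alpha\in(0,1]$, for a real function $u$ of $(x,t)$ given on $\Omega=[a,b]\times[a,b]$: for $0<\alpha<1$, $$\frac{\partial^{\alpha}u}{\partial x^{\alpha}}(x,t)=\frac{1}{\Gamma(1-\alpha)}\int_0^x (x-\tau)^{-\alpha}\,\frac{\partial u}{\partial \tau}(\tau,t)\,d\tau,$$ with lower terminal $0$ (independent of $a$); being defined at $(x,t)$ means that $x\ge 0$, that $(\tau,t)$ belongs to the domain $\Omega$ of $u$ for all $\tau\in[0,x]$, that $\frac{\partial u}{\partial\tau}(\tau,t)$ exists for $\tau\in(0,x)$, and that the integrand is Lebesgue integrable on $(0,x)$. For $\alpha=1$ it is the ordinary partial derivative $\frac{\partial u}{\partial x}(x,t)$. Ordinary partial derivatives at boundary points of $\Omega$ are one-sided. The operator $D^{\alpha}$ is $D^{\alpha}u=\frac{\partial u}{\partial t}+\frac{\partial^{\alpha}u}{\partial x^{\alpha}}$, and $D^{j\alpha}=D^{\alpha}\circ D^{\alpha}\circ\cdots\circ D^{\alpha}$ ($j$ times), with $D^{0\cdot\alpha}u=u$. The fractional partial Wronskian of $\Phi_1,\dots,\Phi_n$ is the function on $\Omega$ given by the $n\times n$ determinant $$W^{\alpha}[\Phi_1,\dots,\Phi_n](x,t)=\det\bigl(D^{j\alpha}\Phi_i(x,t)\bigr)_{0\le j\le n-1,\;1\le i\le n},$$ whose rows are indexed by $j$ and columns by $i$. *)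

(* Defs.v *)
From mathcomp Require Import all_boot all_order all_algebra.
From mathcomp Require Import all_classical all_reals all_analysis.

Set Implicit Arguments.
Unset Strict Implicit.
Unset Printing Implicit Defensive.

Import Order.TTheory GRing.Theory Num.Theory.
Import numFieldNormedType.Exports.

Local Open Scope classical_set_scope.
Local Open Scope ring_scope.

Section FractionalCalculus.
Context {R : realType}.
Implicit Types (a b alpha x t tau z : R) (f : R -> R) (u : R -> R -> R).

(* A function on [Omega a b] is represented by a total [u : R -> R -> R]; the
   operators below, at points of [Omega a b] where they are defined, depend only
   on the values of [u] on [Omega a b].  Elsewhere their values are junk. *)
Definition Omega a b : set (R * R) := `[a, b]%classic `*` `[a, b]%classic.

(* The increments h are restricted to a <= x + h <= b, so that the derivative is
   the ordinary one for a < x < b and is one-sided at x = a and x = b. *)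
Definition increments a b x : set_system R :=
  within [set h | h + x \in `[a, b]] 0^'.

Definition diff_quotient f x : R -> R := fun h => h^-1 * (f (h + x) - f x).

Definition derivable_on a b f x : Prop :=
  cvg (diff_quotient f x @ increments a b x).

Definition deriv_on a b f x : R :=
  lim (diff_quotient f x @ increments a b x).

(* Euler's integral, for z > 0. *)
Definition Gamma z : R :=
  (\int[@lebesgue_measure R]_(s in `]0, +oo[) (s `^ (z - 1) * expR (- s)))%R.

Definition partial_x a b u x t : R := deriv_on a b (u ^~ t) x.
Definition partial_t a b u x t : R := deriv_on a b (u x) t.

Definition caputo_integrand a b alpha u x t : R -> R :=
  fun tau => (x - tau) `^ (- alpha) * partial_x a b u tau t.

Definition caputo_x a b alpha u x t : R :=
  if alpha == 1 then partial_x a b u x t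
  else (Gamma (1 - alpha))^-1 *
       (\int[@lebesgue_measure R]_(tau in `]0, x[)
          caputo_integrand a b alpha u x t tau)%R.

Definition caputo_x_defined a b alpha u x t : Prop :=
  if alpha == 1 then derivable_on a b (u ^~ t) x
  else [/\ 0 <= x,
           forall tau, tau \in `[0, x] -> Omega a b (tau, t),
           forall tau, tau \in `]0, x[ -> derivable_on a b (u ^~ t) tau &
           (@lebesgue_measure R).-integrable `]0, x[
             (EFin \o caputo_integrand a b alpha u x t)].

Definition Dalpha a b alpha u : R -> R -> R :=
  fun x t => partial_t a b u x t + caputo_x a b alpha u x t.

Definition Dalpha_defined a b alpha u x t : Prop :=
  derivable_on a b (u x) t /\ caputo_x_defined a b alpha u x t.

Definition Dalpha_iter a b alpha j u : R -> R -> R :=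
  iter j (Dalpha a b alpha) u.

(* [Dalpha_iter j.+1 u] is [Dalpha] applied to [Dalpha_iter j u], which must
   itself already be a function on all of [Omega a b]. *)
Fixpoint Dalpha_iter_defined a b alpha j u : Prop :=
  if j is i.+1 then
    Dalpha_iter_defined a b alpha i u /\
    forall x t, Omega a b (x, t) ->
      Dalpha_defined a b alpha (Dalpha_iter a b alpha i u) x t
  else True.

Definition fractional_wronskian a b alpha n (Phi : 'I_n -> R -> R -> R) x t : R :=
  \det (\matrix_(j < n, i < n) Dalpha_iter a b alpha j (Phi i) x t).

End FractionalCalculus.

(* Main.v *)
Require Import Defs.
From mathcomp Require Import all_boot all_order all_algebra.
From mathcomp Require Import all_classical all_reals all_analysis.
From mathcomp Require Import lra.

Import Order.TTheory GRing.Theory Num.Theory.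
Import numFieldNormedType.Exports.

Local Open Scope classical_set_scope.
Local Open Scope ring_scope.

(* Each of the limits and integrals that make up the operator D^alpha is linear,
   so D^alpha preserves every linear relation that holds on all of Omega: if
   sum_i k_i Phi_i vanishes on Omega, then so does sum_i k_i D^(j alpha) Phi_i.
   Hence (k_i) is in the kernel of the Wronskian matrix at every point of Omega,
   in particular at one where that matrix is invertible. *)

(** Properness makes the limit in [deriv_on] unique, hence linear. As [a < b], there is room for
    arbitrarily small nonzero increments on at least one side of [x]: to the right if [x < b], to
    the left if [x = b]. *)
Lemma increments_proper {R : realType} {a b x : R} :
  a < b -> x \in `[a, b] -> ProperFilter (increments a b x).
Proof.
move=> ab; rewrite in_itv/= => /andP[ax xb].
apply: Build_ProperFilter_ex => B [e /= e0 eB].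
(* Increments of size at most [e / 2] lie strictly inside the open ball of radius [e]. *)
have e20 : 0 < e / 2 by rewrite divr_gt0.
have ball_e h : 0 < `|h| <= e / 2 -> h + x \in `[a, b] -> B h.
  move=> /andP[h0 he] hx; apply: eB => //=; last by rewrite -normr_gt0.
  by rewrite sub0r normrN; lra.
have [xltb|bx] := ltP x b.
  pose h := Num.min (e / 2) (b - x).
  have [h0 [he hb]] : 0 < h /\ h <= e / 2 /\ h <= b - x.
    by rewrite lt_min e20 subr_gt0 xltb !ge_min !lexx orbT.
  by exists h; apply: ball_e; rewrite ?gtr0_norm ?in_itv//=; lra.
pose h := Num.min (e / 2) (x - a).
have [h0 [he ha]] : 0 < h /\ h <= e / 2 /\ h <= x - a.
  by rewrite lt_min e20 subr_gt0 (lt_le_trans ab bx) !ge_min !lexx orbT.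
by exists (- h); apply: ball_e; rewrite ?normrN ?gtr0_norm ?in_itv//=; lra.
Qed.

Section LinearRelations.
Context {R : realType} {I : Type}.
Variables (a b : R) (s : seq I) (k : I -> R).
Implicit Types (alpha x t : R).

Lemma deriv_on_linear_relation (f : I -> R -> R) x :
  a < b -> x \in `[a, b] -> (forall i, derivable_on a b (f i) x) ->
  (forall y, y \in `[a, b] -> \sum_(i <- s) k i * f i y = 0) ->
  \sum_(i <- s) k i * deriv_on a b (f i) x = 0.
Proof.
move=> ab xab df f0; have FP := increments_proper ab xab.
have cvg_sum : \sum_(i <- s) k i * diff_quotient (f i) x h
    @[h --> increments a b x] --> \sum_(i <- s) k i * deriv_on a b (f i) x.
  apply: cvg_big => [|i _]; first exact: add_continuous.
  by apply: cvgMl_tmp; exact: df.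
rewrite -(cvg_lim (@Rhausdorff R) cvg_sum); apply: lim_near_cst => //.
(* The filter sees only [h] with [h + x] in [[a, b]], where the relation holds at both [h + x] and
   [x]; so the combined difference quotient is exactly 0. *)
apply: filterS (withinT _ _) => h /= hab.
under eq_bigr do rewrite /diff_quotient mulrCA mulrBr.
by rewrite -mulr_sumr sumrB !f0// subrr mulr0.
Qed.

Lemma Rintegral_linear_relation d (T : measurableType d)
    (mu : {measure set T -> \bar R}) (D : set T) (g : I -> T -> R) :
  measurable D -> (forall i, mu.-integrable D (EFin \o g i)) ->
  (forall y, D y -> \sum_(i <- s) k i * g i y = 0) ->
  \sum_(i <- s) k i * \int[mu]_(y in D) g i y = 0.
Proof.
move=> mD ig g0.
under eq_bigr do rewrite -RintegralZl//.
have ikg i : mu.-integrable D (fun y => (k i * g i y)%:E).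
  under eq_fun do rewrite EFinM.
  by apply: integrableZl => //; exact: ig.
(* Real integrals are [fine] of extended ones; integrability makes these finite, so [fine] commutes
   with the sum. *)
rewrite sum_fine; last by move=> i _; exact: integrable_fin_num.
rewrite -integral_sum//.
under eq_integral => y /set_mem Dy do rewrite sumEFin g0//.
by rewrite integral0.
Qed.

(** The relation passes to the time derivatives, and to the Caputo terms through their integrands.
    This is the induction step for the iterates. *)
Lemma Dalpha_linear_relation alpha (u : I -> R -> R -> R) :
  a < b ->
  (forall i x t, Omega a b (x, t) -> Dalpha_defined a b alpha (u i) x t) ->
  (forall x t, Omega a b (x, t) -> \sum_(i <- s) k i * u i x t = 0) ->
  forall x t, Omega a b (x, t) ->
    \sum_(i <- s) k i * Dalpha a b alpha (u i) x t = 0.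
Proof.
move=> ab du u0 x t Oxt; have [/= xab tab] := Oxt.
under eq_bigr do rewrite /Dalpha mulrDr.
have pt0 : \sum_(i <- s) k i * partial_t a b (u i) x t = 0.
  apply: deriv_on_linear_relation => // [i|y yab]; last exact: u0.
  by have [] := du i x t Oxt.
rewrite big_split/= pt0 add0r.
have {du} du i : caputo_x_defined a b alpha (u i) x t.
  by have [] := du i x t Oxt.
move: du; rewrite /caputo_x_defined /caputo_x; case: (alpha == 1) => du.
  by apply: deriv_on_linear_relation => // y yab; exact: u0.
under eq_bigr do rewrite mulrCA.
rewrite -mulr_sumr -[RHS](mulr0 (Gamma (1 - alpha))^-1); congr *%R.
apply: Rintegral_linear_relation => [//|i|]; first by have [] := du i.
(* That the segment from [(0, t)] to [(x, t)] stays in [Omega a b] is read off the definedness of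
   one Caputo term, so an index [i0] is needed; an empty sum is 0 anyway. *)
move=> tau tau_x; case sE: s => [|i0 s']; first by rewrite big_nil.
have [_ sub0x _ _] := du i0.
have Otaut y : y \in `[0, x] -> Omega a b (y, t) by exact: sub0x.
have [/= tau_ab _] : Omega a b (tau, t) by apply/Otaut/subset_itv_oo_cc.
rewrite -sE; under eq_bigr do rewrite /caputo_integrand mulrCA.
have px0 : \sum_(i <- s) k i * partial_x a b (u i) tau t = 0.
  apply: deriv_on_linear_relation => // [i|y yab]; last exact: u0.
  by have [_ _ + _] := du i; exact.
by rewrite -mulr_sumr px0 mulr0.
Qed.

End LinearRelations.

Theorem theorem2p1 (R : realType) (a b alpha : R) (n : nat)
    (Phi : 'I_n -> R -> R -> R)
    (hab : a < b) (halpha : 0 < alpha <= 1) (hn : (1 <= n)%N)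
    (hdef : forall (i : 'I_n) (j : nat), (1 <= j <= n.-1)%N ->
       Dalpha_iter_defined a b alpha j (Phi i))
    (hW : exists x t : R, Omega a b (x, t) /\
       fractional_wronskian a b alpha Phi x t != 0)
    (k : 'I_n -> R)
    (hk : forall x t : R, Omega a b (x, t) -> \sum_(i < n) k i * Phi i x t = 0) :
  forall i : 'I_n, k i = 0.
Proof.
have hkD j : (j < n)%N -> forall x t, Omega a b (x, t) ->
    \sum_(i < n) k i * Dalpha_iter a b alpha j (Phi i) x t = 0.
  elim: j => [_|j IHj jn]; first exact: hk.
  apply: Dalpha_linear_relation => // [i x t Oxt|]; last exact/IHj/ltnW.
  (* Definedness at [j.+1], available since [j.+1 <= n.-1], includes that of [Dalpha] on the [j]-th
     iterate at every point of [Omega a b]. *)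
  have [|_] := hdef i j.+1; first by rewrite /= ltn_predRL.
  exact.
have [x [t [Oxt]]] := hW; rewrite /fractional_wronskian.
set W := \matrix_(_, _) _ => detW.
have Wu : W \in unitmx by rewrite unitmxE unitfE.
(* Row [j] of this product is the relation [hkD j] at [(x, t)]. *)
have Wk : W *m (\col_i k i) = 0.
  apply/colP => j; rewrite !mxE -[RHS](hkD j (ltn_ord j) x t Oxt).
  by apply: eq_bigr => i _; rewrite !mxE mulrC.
have k0 : \col_i k i = 0 by rewrite -[LHS](mulKmx Wu) Wk mulmx0.
by move=> i; have /colP/(_ i) := k0; rewrite !mxE.
Qed.
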